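(* Let $f:\mathbb{R}^n\times\mathbb{R}^m\to\mathbb{R}^n$ be locally Lipschitz, let $\mathbb{U}\subseteq\mathbb{R}^m$, let $k:\mathbb{R}^n\to\mathbb{U}$ be locally Lipschitz continuous, and let $F(x)=f(x,k(x))$. Let $N\ge 1$ be an integer, let $h_i:\mathbb{R}^n\to\mathbb{R}$ be continuously differentiable for $i\in\{1,\dots,N\}$, let $\hat h(x)=\min_{1\le i\le N}h_i(x)$, and suppose that $\hat{\mathcal S}=\{x\in\mathbb{R}^n : \hat h(x)\ge 0\}$ is compact, that MFCQ holds for $\partial\hat{\mathcal S}$, and that the closed-loop system $\dot x=F(x)$ is strictly safe with respect to $\hat{\mathcal S}$. Let $\varepsilon,M,r,d>0$ be constants such that for all $x\in T_\varepsilon=\{x\in\hat{\mathcal S} : 0\le \hat h(x)\le\varepsilon\}$, $$\max_{1\le i\le N}|L_Fh_i(x)|\le M,\qquad \min_{i\in\mathcal A(x)}L_Fh_i(x)\ge r,\qquad \min_{j\in\mathcal P(x)}\delta_j(x)\ge d.$$ Then, for every $\theta>\theta^*$, where $$\theta^*=\max\left\{\frac{\log N}{\varepsilon},\ \frac1d\log\left(\frac{N(r+M)}{r}\right)\right\},$$ the function $\tilde h_\theta(x)=-\frac1\theta\log\left(\sum_{i=1}^N e^{-\theta h_i(x)}\right)$ is a CBF for the system $\dot x=f(x,u)$, $u\in\mathbb{U}$.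
   Context: Notation: $L_F g(x)=\nabla g(x)^\top F(x)$. For $x\in\hat{\mathcal S}$, the active index set is $\mathcal A(x)=\{i\in\{1,\dots,N\} : h_i(x)=\hat h(x)\}$, the inactive index set is $\mathcal P(x)=\{1,\dots,N\}\setminus\mathcal A(x)$, and $\delta_j(x)=h_j(x)-\hat h(x)$. A minimum over an empty index set is taken to be $+\infty$ (the bound is then vacuous). MFCQ (Mangasarian–Fromovitz constraint qualification) holds for $\partial\hat{\mathcal S}$ if for every $x\in\partial\hat{\mathcal S}$ there exists $v\in\mathbb{R}^n$ such that $\nabla h_i(x)^\top v>0$ for all $i\in\mathcal A(x)$. Strict safety: $\dot x=F(x)$, $x(0)=x_0$, is strictly safe with respect to a set $\mathcal{S}$ if for every $x_0\in\mathcal{S}$ the solution satisfies $x(t)\in\mathrm{Int}(\mathcal{S})$ for all $t>0$. Class $\mathcal K$: continuous strictly increasing functions $\alpha:[0,a)\to\mathbb{R}_{\ge0}$ (with $a\in(0,\infty]$) with $\alpha(0)=0$. CBF (control barrier function): a continuously differentiable $g:\mathbb{R}^n\to\mathbb{R}$ is a CBF for $\dot x=f(x,u)$, $u\in\mathbb{U}$, if there is $\alpha\in\mathcal K$ with $\sup_{u\in\mathbb{U}}\nabla g(x)^\top f(x,u)\ge-\alpha(g(x))$ for all $x$ with $g(x)\ge0$. *)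

(* Defs.v *)
From HB Require Import structures.
From mathcomp Require Export all_boot all_order all_algebra.
From mathcomp Require Export all_classical all_reals all_analysis.
Export Order.TTheory GRing.Theory Num.Theory.
Export numFieldNormedType.Exports.

Set Implicit Arguments.
Unset Strict Implicit.
Unset Printing Implicit Defensive.

Local Open Scope classical_set_scope.
Local Open Scope ring_scope.

Section Calculus.
Context {R : realType}.

(* [lipschitz f y | y in A] asserts that some Lipschitz constant works on A. *)
Definition locally_lipschitz {V W : normedModType R} (f : V -> W) : Prop :=
  forall x : V, exists2 A : set V, nbhs x A & [lipschitz f y | y in A].

Definition grad {n : nat} (g : 'cV[R]_n -> R) (x : 'cV[R]_n) : 'cV[R]_n :=
  \col_i 'D_(delta_mx i 0) g x.

Definition continuously_differentiable {n : nat} (g : 'cV[R]_n -> R) : Prop :=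
  (forall x, differentiable g x) /\ continuous (grad g).

Definition grad_dot {n : nat} (g : 'cV[R]_n -> R) (x v : 'cV[R]_n) : R :=
  ((grad g x)^T *m v) 0 0.

Definition lieD {n : nat} (F : 'cV[R]_n -> 'cV[R]_n) (g : 'cV[R]_n -> R)
    (x : 'cV[R]_n) : R :=
  grad_dot g x (F x).

Definition boundary {T : topologicalType} (A : set T) : set T :=
  closure A `\` A°.

End Calculus.

Section ControlSystems.
Context {R : realType} {n m : nat}.
Implicit Types (F : 'cV[R]_n -> 'cV[R]_n) (S : set 'cV[R]_n).

(* Solutions on [0, +oo[; the derivative at time 0 is one-sided, and the values
   of phi at negative times are irrelevant. *)
Definition is_solution F (x0 : 'cV[R]_n) (phi : R -> 'cV[R]_n) : Prop :=
  [/\ phi 0 = x0,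
      s^-1 *: (phi s - phi 0) @[s --> 0^'+] --> F (phi 0)
    & forall t : R, 0 < t -> is_derive t 1 phi (F (phi t))].

(* "The solution satisfies phi(t) in Int S for all t > 0" includes that it exists
   for all times; for locally Lipschitz F it is unique. *)
Definition strictly_safe F S : Prop :=
  forall x0, S x0 ->
    (exists phi, is_solution F x0 phi) /\
    (forall phi, is_solution F x0 phi -> forall t, 0 < t -> S° (phi t)).

Definition closed_loop (f : 'cV[R]_n * 'cV[R]_m -> 'cV[R]_n)
    (k : 'cV[R]_n -> 'cV[R]_m) (x : 'cV[R]_n) : 'cV[R]_n :=
  f (x, k x).

(* alpha is a class K function with domain [0, a[, where a may be +oo; the values
   of alpha outside [0, a[ are irrelevant. *)
Definition classK (a : \bar R) (alpha : R -> R) : Prop :=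
  let D := [set s : R | 0 <= s /\ (s%:E < a)%E] in
  [/\ (0 < a)%E,
      {within D, continuous alpha},
      forall s t, D s -> D t -> s < t -> alpha s < alpha t,
      forall s, D s -> 0 <= alpha s
    & alpha 0 = 0].

(* The condition g x < a says that alpha (g x) is defined. The supremum is
   extended-real: it may be +oo. *)
Definition is_CBF (f : 'cV[R]_n * 'cV[R]_m -> 'cV[R]_n) (U : set 'cV[R]_m)
    (g : 'cV[R]_n -> R) : Prop :=
  continuously_differentiable g /\
  exists (a : \bar R) (alpha : R -> R),
    classK a alpha /\
    forall x, 0 <= g x ->
      ((g x)%:E < a)%E /\
      (- (alpha (g x))%:E <=
         ereal_sup [set (grad_dot g x (f (x, u)))%:E | u in U])%E.

End ControlSystems.

(* A family of N + 1 >= 1 constraint functions, indexed from 0. *)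
Section Constraints.
Context {R : realType} {n N : nat}.
Variable h : 'I_N.+1 -> 'cV[R]_n -> R.

Definition hmin (x : 'cV[R]_n) : R :=
  \big[Num.min/h ord0 x]_(i < N.+1) h i x.

Definition safe_set : set 'cV[R]_n := [set x | 0 <= hmin x].

Definition active (x : 'cV[R]_n) : {set 'I_N.+1} :=
  [set i | h i x == hmin x]%SET.

Definition inactive (x : 'cV[R]_n) : {set 'I_N.+1} := (~: active x)%SET.

Definition gap (j : 'I_N.+1) (x : 'cV[R]_n) : R := h j x - hmin x.

Definition MFCQ : Prop :=
  forall x, boundary safe_set x ->
    exists v : 'cV[R]_n, forall i, i \in active x -> 0 < grad_dot (h i) x v.

Definition tube (eps : R) : set 'cV[R]_n :=
  [set x | safe_set x /\ 0 <= hmin x <= eps].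

Definition softmin (theta : R) (x : 'cV[R]_n) : R :=
  - (theta^-1 * ln (\sum_(i < N.+1) expR (- (theta * h i x)))).

End Constraints.

(* Main.v *)
(* The gradient of the soft minimum is the average of the gradients of the h_i with
   weights proportional to exp(- theta h_i), and
   hmin - log N / theta <= softmin <= hmin.  Hence softmin >= 0 forces hmin >= 0, and
   softmin < c := eps - log N / theta forces hmin < eps.  On the tube the inactive
   weights are at most exp(- theta d), so the choice of theta makes the positive
   contribution r of the active constraints dominate the loss, at most M, of the
   inactive ones, and the Lie derivative of softmin is nonnegative.  Off the tube
   softmin >= c, and the Lie derivative is bounded below by some - K by compactness;
   so the linear class K function alpha(s) = (K / c) s works everywhere. *)
Require Import Defs.
From mathcomp Require Import all_boot all_order all_algebra.
From mathcomp Require Import all_classical all_reals all_analysis.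
From mathcomp Require Import ring.
Import Order.TTheory GRing.Theory Num.Theory.
Import numFieldNormedType.Exports.
Local Open Scope classical_set_scope.
Local Open Scope ring_scope.


Set Implicit Arguments.

(** * Continuity, boundedness on compact sets, and a chain rule *)

Lemma locally_lipschitz_continuous (R : realType) (V W : normedModType R)
  (f : V -> W) : locally_lipschitz f -> continuous f.
Proof.
move=> f_lip x; have [A xA A_lip] := f_lip x.
have [M M_gt0 fM] := pinfty_ex_gt0 A_lip.
have Ax : A x := nbhs_singleton xA.
apply/cvgrPdist_le => e e_gt0; near=> y.
have /= fxy : `|f x - f y| <= M * `|x - y|.
  by apply: (fM (x, y)); split => //=; near: y.
apply: (le_trans fxy); rewrite -ler_pdivlMl//; near: y.
by apply: cvgr_dist_le => //; rewrite mulr_gt0 ?invr_gt0.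
Unshelve. all: by end_near. Qed.

Lemma continuous_sumr (R : realType) (T : topologicalType)
  (V : normedModType R) (I : Type) (s : seq I) (F : I -> T -> V) :
  (forall i, continuous (F i)) -> continuous (fun x => \sum_(i <- s) F i x).
Proof.
move=> F_cont; elim: s => [|i s IHs] x.
  by under eq_fun do rewrite big_nil; exact: cvg_cst.
under eq_fun do rewrite big_cons.
exact: (cvgD (F_cont i x) (IHs x)).
Qed.

Lemma continuous_lieD (R : realType) (n : nat) (F : 'cV[R]_n -> 'cV[R]_n)
  (g : 'cV[R]_n -> R) :
  continuous F -> continuous (grad g) -> continuous (lieD F g).
Proof.
move=> F_cont g_cont.
have -> : lieD F g = fun x => \sum_(j < n) grad g x j 0 * F x j 0.
  apply/funext => x; rewrite /lieD /grad_dot mxE.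
  by apply: eq_bigr => j _; rewrite mxE.
apply: continuous_sumr => j x.
have coord_cont (G : 'cV[R]_n -> 'cV[R]_n) : continuous G ->
    {for x, continuous (fun y => G y j 0)}.
  move=> G_cont; apply: (@continuous_comp _ _ _ G (fun v : 'cV_n => v j 0)).
    exact: G_cont.
  exact: coord_continuous.
exact: (cvgM (coord_cont _ g_cont) (coord_cont _ F_cont)).
Qed.

Lemma compact_bounded_fun (R : realType) (T : topologicalType) (A : set T)
  (f : T -> R) : compact A -> continuous f ->
  exists2 K : R, 0 < K & forall x, A x -> `|f x| <= K.
Proof.
move=> A_compact f_cont.
have /compact_bounded[K [_ fK]] :=
  continuous_compact (continuous_subspaceT f_cont) A_compact.
(* Boundedness yields a bound for every real above [K]; this one is also positive. *)
exists (`|K| + 1); first by rewrite ltr_wpDl.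
move=> x Ax; apply: (fK (`|K| + 1)); last by exists x.
by rewrite (le_lt_trans (ler_norm K))// ltrDl.
Qed.

(** Since [g] is scalar, its differential at [f x] is multiplication by [dg]. *)
Lemma is_derive_comp_real (R : realType) (V : normedModType R) (f : V -> R)
  (g : R -> R) (x v : V) (dg : R) :
  differentiable f x -> is_derive (f x) 1 g dg ->
  is_derive x v (g \o f) (dg * 'D_v f x).
Proof.
move=> f_diff [g_der g_val].
have g_diff : differentiable g (f x) by apply/derivable1_diffP.
apply: DeriveDef.
  by apply: diff_derivable; exact: differentiable_comp.
rewrite deriveE; last exact: differentiable_comp.
by rewrite diff_comp//= diff1E// derive1E g_val -deriveE// mulrC.
Qed.

(** * Bounds on the soft minimum and its weights *)

Section SoftMin.
Context {R : realType} {n N : nat}.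
Variables (h : 'I_N.+1 -> 'cV[R]_n -> R) (theta : R).
Hypothesis theta_gt0 : 0 < theta.

Definition expsum (x : 'cV[R]_n) : R :=
  \sum_(i < N.+1) expR (- (theta * h i x)).

(** The softmax weights of the values [- theta * h i x]. *)
Definition weight (i : 'I_N.+1) (x : 'cV[R]_n) : R :=
  expR (- (theta * h i x)) / expsum x.

Lemma hmin_le (x : 'cV[R]_n) (i : 'I_N.+1) : hmin h x <= h i x.
Proof. exact: bigmin_le. Qed.

(** The default value of the big minimum is [h ord0 x], itself one of the values. *)
Lemma hmin_attained (x : 'cV[R]_n) : exists i, h i x = hmin h x.
Proof.
rewrite /hmin; elim/big_rec: _ => [|i y _ [j <-]]; first by exists ord0.
by case: (leP (h i x) (h j x)) => _; [exists i | exists j].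
Qed.

Lemma expsum_gt0 (x : 'cV[R]_n) : 0 < expsum x.
Proof.
rewrite /expsum big_ord_recl ltr_pwDl ?expR_gt0//.
by apply: sumr_ge0 => i _; exact: expR_ge0.
Qed.

Lemma weight_ge0 (i : 'I_N.+1) (x : 'cV[R]_n) : 0 <= weight i x.
Proof. by rewrite divr_ge0 ?expR_ge0// ltW ?expsum_gt0. Qed.

Lemma sum_weight (x : 'cV[R]_n) : \sum_i weight i x = 1.
Proof. by rewrite -mulr_suml divff// gt_eqF ?expsum_gt0. Qed.

Lemma expsum_ge (x : 'cV[R]_n) : expR (- (theta * hmin h x)) <= expsum x.
Proof.
have [i <-] := hmin_attained x; rewrite /expsum (bigD1 i)//= lerDl.
by apply: sumr_ge0 => j _; exact: expR_ge0.
Qed.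

Lemma expsum_le (x : 'cV[R]_n) :
  expsum x <= N.+1%:R * expR (- (theta * hmin h x)).
Proof.
rewrite mulr_natl -[X in _ *+ X](card_ord N.+1) -sumr_const.
by apply: ler_sum => i _; rewrite ler_expR lerN2 ler_pM2l ?hmin_le.
Qed.

Lemma softmin_le (x : 'cV[R]_n) : softmin h theta x <= hmin h x.
Proof.
rewrite /softmin lerNl ler_pdivlMl// mulrN -ler_expR.
by rewrite lnK ?posrE ?expsum_gt0 ?expsum_ge.
Qed.

Lemma softmin_ge (x : 'cV[R]_n) :
  hmin h x - ln N.+1%:R / theta <= softmin h theta x.
Proof.
rewrite /softmin lerNr opprB ler_pdivrMl//.
rewrite mulrBr mulrCA divff ?gt_eqF// mulr1 -ler_expR.
rewrite lnK ?posrE ?expsum_gt0// expRD lnK ?posrE ?ltr0n//.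
exact: expsum_le.
Qed.

(** The denominator is at least its largest term, which is attained at a minimizing index. *)
Lemma weight_le_gap (x : 'cV[R]_n) (d : R) (j : 'I_N.+1) :
  d <= gap h j x -> weight j x <= expR (- (theta * d)).
Proof.
move=> d_le; rewrite ler_pdivrMr ?expsum_gt0//.
apply: le_trans (ler_wpM2l (expR_ge0 _) (expsum_ge x)).
rewrite -expRD ler_expR -opprD lerN2 -mulrDr ler_pM2l//.
by rewrite -lerBrDr.
Qed.

(** * Differentiation of the soft minimum *)

Hypothesis h_C1 : forall i, continuously_differentiable (h i).

(** The sum is taken in the space of functions, the form to which the rules for sums and
    compositions apply. *)
Lemma softmin_comp : softmin h theta =
  (fun y => - (theta^-1 * ln y)) \o
  (\sum_(i < N.+1) ((fun y => expR (- (theta * y))) \o h i)).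
Proof. by apply/funext => x; rewrite /softmin /= fct_sumE. Qed.

Let is_derive_exp_scale (y : R) :
  is_derive y 1 (fun y => expR (- (theta * y))) (- theta * expR (- (theta * y))).
Proof.
have -> : (fun y => expR (- (theta * y))) = expR \o (- theta *: id).
  by apply/funext => z; rewrite -mulNr.
have dscale := is_deriveZ (- theta) (is_derive_id y (1 : R)).
apply: is_derive_eq (is_derive1_comp (is_derive_expR _) dscale) _.
by rewrite /= mulrC -mulNr [_ *: 1]mulr1.
Qed.

Let is_derive_ln_scale (y : R) : 0 < y ->
  is_derive y 1 (fun y => - (theta^-1 * ln y)) (- (theta^-1 * y^-1)).
Proof.
move=> y_gt0; have := is_deriveZ (- theta^-1) (is_derive1_ln y_gt0).
rewrite -mulNr; congr is_derive.
by apply/funext => z; rewrite -mulNr.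
Qed.

Let differentiable_exp_comp (i : 'I_N.+1) (x : 'cV[R]_n) :
  differentiable ((fun y => expR (- (theta * y))) \o h i) x.
Proof.
apply: differentiable_comp; first exact: (h_C1 i).1.
by apply/derivable1_diffP; have [] := is_derive_exp_scale (h i x).
Qed.

Let expsumE (x : 'cV[R]_n) :
  (\sum_(i < N.+1) ((fun y => expR (- (theta * y))) \o h i)) x = expsum x.
Proof. by rewrite fct_sumE. Qed.

Lemma differentiable_softmin (x : 'cV[R]_n) : differentiable (softmin h theta) x.
Proof.
rewrite softmin_comp; apply: differentiable_comp.
  exact: differentiable_sum.
apply/derivable1_diffP; rewrite expsumE.
by have [] := is_derive_ln_scale _ (expsum_gt0 x).
Qed.

Lemma derive_softmin (x v : 'cV[R]_n) :
  'D_v (softmin h theta) x = \sum_i weight i x * 'D_v (h i) x.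
Proof.
have Dsum : 'D_v (\sum_(i < N.+1) ((fun y => expR (- (theta * y))) \o h i)) x =
    \sum_(i < N.+1) (- theta * expR (- (theta * h i x))) * 'D_v (h i) x.
  apply: derive_val; apply: is_derive_sum => i.
  by apply: is_derive_comp_real; [exact: (h_C1 i).1|exact: is_derive_exp_scale].
rewrite softmin_comp.
have dln := is_derive_ln_scale _ (expsum_gt0 x); rewrite -expsumE in dln.
rewrite (derive_val (is_derive := is_derive_comp_real _ _ dln)); last first.
  exact: differentiable_sum.
rewrite expsumE Dsum mulr_sumr; apply: eq_bigr => i _; rewrite /weight.
(* The factor [- theta] from the exponential cancels [- theta^-1] in front of the logarithm. *)
by field; rewrite !gt_eqF ?expsum_gt0.
Qed.

Lemma grad_softmin : grad (softmin h theta) =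
  fun x => \sum_i weight i x *: grad (h i) x.
Proof.
apply/funext => x; apply/matrixP => j k; rewrite mxE derive_softmin summxE.
by apply: eq_bigr => i _; rewrite !mxE.
Qed.

Lemma lieD_softmin (F : 'cV[R]_n -> 'cV[R]_n) (x : 'cV[R]_n) :
  lieD F (softmin h theta) x = \sum_i weight i x * lieD F (h i) x.
Proof.
rewrite /lieD /grad_dot grad_softmin linear_sum mulmx_suml summxE.
by apply: eq_bigr => i _; rewrite linearZ /= -scalemxAl mxE.
Qed.

Lemma continuous_weight (i : 'I_N.+1) : continuous (weight i).
Proof.
have E_cont j : continuous (fun x => expR (- (theta * h j x))).
  by move=> x; exact: (differentiable_continuous (differentiable_exp_comp j x)).
have S_cont : continuous expsum by exact: continuous_sumr.
move=> x; have Sx_neq0 : expsum x != 0 by rewrite gt_eqF ?expsum_gt0.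
exact: (cvgM (E_cont i x) (cvgV Sx_neq0 (S_cont x))).
Qed.

Lemma continuously_differentiable_softmin :
  continuously_differentiable (softmin h theta).
Proof.
split; first exact: differentiable_softmin.
rewrite grad_softmin; apply: continuous_sumr => i x.
exact: (cvgZ (@continuous_weight i x) ((h_C1 i).2 x)).
Qed.

(** Lowering an inactive value from [r] to [- M] costs at most [expR (- (theta * d)) * (r + M)]. As
    the weights sum to 1, the total is at least [r] minus [N.+1] such costs, which the exponential
    hypothesis makes nonnegative. *)
Lemma lieD_softmin_ge0 (F : 'cV[R]_n -> 'cV[R]_n) (x : 'cV[R]_n) (M r d : R) :
  0 < M -> 0 < r -> N.+1%:R * (r + M) / r <= expR (theta * d) ->
  (forall i, - M <= lieD F (h i) x) ->
  (forall i, i \in active h x -> r <= lieD F (h i) x) ->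
  (forall j, j \in inactive h x -> d <= gap h j x) ->
  0 <= lieD F (softmin h theta) x.
Proof.
move=> M_gt0 r_gt0 Nexp geM ger ged; rewrite lieD_softmin.
(* Charging the loss to every index, active or not, avoids splitting the sum. *)
have lower i : weight i x * r - expR (- (theta * d)) * (r + M)
    <= weight i x * lieD F (h i) x.
  have [iA|iNA] := boolP (i \in active h x).
    apply: (@le_trans _ _ (weight i x * r)).
      by rewrite gerBl mulr_ge0 ?expR_ge0// addr_ge0 ?ltW.
    by rewrite ler_wpM2l ?weight_ge0 ?ger.
  have wd : weight i x <= expR (- (theta * d)).
    by apply: weight_le_gap (ged i _); rewrite finset.in_setC.
  apply: (@le_trans _ _ (weight i x * - M)); last first.
    by rewrite ler_wpM2l ?weight_ge0.
  (* The claim rearranges to [wd] multiplied by [r + M]. *)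
  rewrite lerBlDr -lerBlDl -mulrBr opprK.
  by rewrite ler_wpM2r// addr_ge0 ?ltW.
apply: le_trans (ler_sum _ (fun i _ => lower i)).
rewrite sumrB -mulr_suml sum_weight mul1r sumr_const card_ord.
by rewrite subr_ge0 -mulr_natl mulrCA expRN ler_pdivrMl ?expR_gt0// -ler_pdivrMr.
Qed.

End SoftMin.

(** * Choice of the class K function *)

Unset Implicit Arguments.

Theorem theorem3 (R : realType) (n m : nat)
  (f : 'cV[R]_n * 'cV[R]_m -> 'cV[R]_n) (U : set 'cV[R]_m)
  (k : 'cV[R]_n -> 'cV[R]_m)
  (f_lip : locally_lipschitz f)
  (k_lip : locally_lipschitz k) (k_U : forall x, U (k x))
  (N : nat) (h : 'I_N.+1 -> 'cV[R]_n -> R)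
  (h_C1 : forall i, continuously_differentiable (h i))
  (S_compact : compact (safe_set h))
  (h_MFCQ : MFCQ h)
  (F_safe : strictly_safe (closed_loop f k) (safe_set h))
  (eps M r d : R) (eps_gt0 : 0 < eps) (M_gt0 : 0 < M) (r_gt0 : 0 < r)
  (d_gt0 : 0 < d)
  (F_bounds : forall x, tube h eps x ->
     [/\ (\big[maxe/-oo]_(i < N.+1) `|lieD (closed_loop f k) (h i) x|%:E
            <= M%:E)%E,
         (r%:E <= \big[mine/+oo]_(i in active h x)
            (lieD (closed_loop f k) (h i) x)%:E)%E
       & (d%:E <= \big[mine/+oo]_(j in inactive h x) (gap h j x)%:E)%E])
  (theta : R)
  (theta_gt : Num.max (ln N.+1%:R / eps) (d^-1 * ln (N.+1%:R * (r + M) / r))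
     < theta) :
  is_CBF f U (softmin h theta).
Proof.
have N1_ge1 : 1 <= N.+1%:R :> R by rewrite ler1n.
move: theta_gt; rewrite gt_max => /andP[theta_eps theta_d].
have theta_gt0 : 0 < theta.
  by apply: le_lt_trans theta_eps; rewrite divr_ge0 ?ln_ge0// ltW.
(* The first lower bound on [theta] says exactly this. *)
have c_gt0 : 0 < eps - ln N.+1%:R / theta.
  by rewrite subr_gt0 ltr_pdivrMr// mulrC -ltr_pdivrMr.
set c := eps - _ in c_gt0.
have g_C1 := continuously_differentiable_softmin _ _ theta_gt0 h_C1.
have F_cont : continuous (closed_loop f k).
  move=> x; apply: (@continuous_comp _ _ _ (fun y => (y, k y)) f).
    exact: (cvg_pair cvg_id (locally_lipschitz_continuous k_lip x)).
  exact: locally_lipschitz_continuous.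
have [K K_gt0 LK] := compact_bounded_fun S_compact (continuous_lieD F_cont g_C1.2).
(* The slope is chosen so that [alpha] reaches [K] at [c]; with domain end [+oo], [alpha] is defined
   at every value of the soft minimum. *)
split=> //; exists +oo%E, ( *%R (K / c)); split.
  split.
  - by rewrite ltry.
  - by apply: continuous_subspaceT; exact: mulrl_continuous.
  - by move=> s t _ _ st; rewrite ltr_pM2l// divr_gt0.
  - by move=> s [s_ge0 _]; rewrite mulr_ge0// divr_ge0// ltW.
  - exact: mulr0.
move=> x gx_ge0; split; first exact: ltry.
(* The feedback [k x] is an admissible control, so its Lie derivative bounds the supremum from
   below. *)
apply: (@le_trans _ _ (lieD (closed_loop f k) (softmin h theta) x)%:E); last first.
  by apply: ereal_sup_ubound; exists (k x).
rewrite -EFinN lee_fin.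
have Sx : safe_set h x := le_trans gx_ge0 (softmin_le _ _ theta_gt0 _).
have [xeps|xeps] := leP (hmin h x) eps; last first.
  apply: (@le_trans _ _ (- K)); last first.
    by have := LK x Sx; rewrite ler_norml => /andP[].
  rewrite lerN2 -mulrA ler_peMr ?(ltW K_gt0)// mulrC ler_pdivlMr// mul1r.
  by apply: le_trans (softmin_ge _ _ theta_gt0 _); rewrite lerB// ltW.
have tx : tube h eps x by split=> //; apply/andP.
(* The discarded components concern the default values [-oo] and [+oo]; what remains are bounds
   index by index. *)
have [/bigmax_leP[_ bM] /bigmin_geP[_ br] /bigmin_geP[_ bd]] := F_bounds x tx.
apply: (@le_trans _ _ 0).
  by rewrite oppr_le0 mulr_ge0// divr_ge0// ltW.
apply: (@lieD_softmin_ge0 _ _ _ h theta theta_gt0 h_C1 _ _ M r d) => //.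
(* The second lower bound on [theta], in exponential form. *)
- rewrite -[leLHS]lnK ?posrE ?divr_gt0 ?mulr_gt0 ?addr_gt0// ler_expR.
  by rewrite [theta * d]mulrC -ler_pdivrMl ?d_gt0 ?ltW.
- by move=> i; have := bM i isT; rewrite lee_fin ler_norml => /andP[].
Qed.
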